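(* Let $q$ be a prime power with $q\le 17$, $q\equiv 1\pmod 4$, $q\neq 5$. Then the rank metric code $\mathcal{C}=\langle x,\,x^q-x^{q^2}+x^{q^4}+x^{q^5}\rangle_{\mathbb{F}_{q^6}}\subseteq\mathcal{L}_{6,q}$ is an $\mathbb{F}_q$-linear MRD-code with parameters $(6,6,q;5)$ whose left idealiser is isomorphic to $\mathbb{F}_{q^6}$, and $\mathcal{C}$ is not equivalent to any code $\mathcal{C}_f=\langle x,f(x)\rangle_{\mathbb{F}_{q^6}}$ with $f(x)$ one of: $x^q$; $\delta x^q+x^{q^5}$ with $\mathrm{N}_{q^6/q}(\delta)\notin\{0,1\}$; $\delta x^q+x^{q^4}$ with $\mathrm{N}_{q^6/q^3}(\delta)\notin\{0,1\}$ such that $\{(x,f(x)):x\in\mathbb{F}_{q^6}\}$ is maximum scattered; $x^q+x^{q^3}+\delta x^{q^5}$ with $\delta^2+\delta=1$.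
   Context: $\mathcal{L}_{n,q}$ is the ring of $q$-polynomials $\sum_{i=0}^{n-1}a_ix^{q^i}$ over $\mathbb{F}_{q^n}$ modulo $x^{q^n}-x$, identified with $\mathrm{End}_{\mathbb{F}_q}(\mathbb{F}_{q^n})$ and hence with $n\times n$ matrices over $\mathbb{F}_q$. A rank metric code is a subset of these matrices with distance $d(A,B)=\mathrm{rk}(A-B)$; an $\mathbb{F}_q$-linear code of $n\times n$ matrices with minimum distance $d$ has parameters $(n,n,q;d)$ and is MRD if $|\mathcal{C}|=q^{n(n-d+1)}$. The left idealiser is $L(\mathcal{C})=\{\varphi\in\mathcal{L}_{n,q}:\varphi\circ f\in\mathcal{C}\ \forall f\in\mathcal{C}\}$. Codes $\mathcal{C}_1,\mathcal{C}_2$ are equivalent if there exist permutation $q$-polynomials $\varphi_1,\varphi_2$ and $\rho\in\mathrm{Aut}(\mathbb{F}_{q^n})$ with $\varphi_1\circ f^{\rho}\circ\varphi_2\in\mathcal{C}_2$ for all $f\in\mathcal{C}_1$, where $f^\rho(x)=\sum f_i^\rho x^{q^i}$. A subspace $\{(x,f(x))\}$ is maximum scattered if $\dim_{\mathbb{F}_q}(U\cap\langle u\rangle_{\mathbb{F}_{q^6}})=1$ for all nonzero $u$ in it. $\mathrm{N}_{q^6/q}(\delta)=\delta^{(q^6-1)/(q-1)}$, $\mathrm{N}_{q^6/q^3}(\delta)=\delta^{q^3+1}$. *)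

(* Defs.v *)
From HB Require Import structures.
From mathcomp Require Import all_boot all_order all_fingroup all_algebra.
From mathcomp Require Import all_solvable all_field.

Set Implicit Arguments.
Unset Strict Implicit.
Unset Printing Implicit Defensive.

Import GRing.Theory.
Local Open Scope ring_scope.

Section QPolynomials.

(* F plays the role of F_q, so q = #|F|, and L that of F_(q^n): the alias     *)
(* finvect_type equips the field extension K with its finite structures.      *)
Variables (F : finFieldType) (K : fieldExtType F) (n : nat).

Local Notation q := #|F|.
Local Notation L := (finvect_type K).

(* A class of q-polynomials modulo x^(q^n) - x is given by the coefficients   *)
(* (a_0, ..., a_(n-1)) of its reduced representative.                         *)
Definition qpoly_ring : Type := 'rV[L]_n.

HB.instance Definition _ := GRing.Lmodule.on qpoly_ring.
HB.instance Definition _ := Vector.on qpoly_ring.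
HB.instance Definition _ := Finite.on qpoly_ring.

Implicit Types (f g : qpoly_ring) (C : {set qpoly_ring}).

Definition qpoly_of f : {poly L} := \sum_(i < n) f 0 i *: 'X^(q ^ i).

Definition qeval f (x : L) : L := (qpoly_of f).[x].

(* x^(q^i), for i < n *)
Definition qmonom (i : nat) : qpoly_ring := \row_(j < n) (j == i :> nat)%:R.

Definition qcomp f g : qpoly_ring :=
  \row_(i < n)
    ((qpoly_of f \Po qpoly_of g) %% ('X^(q ^ n) - 'X))`_(q ^ i).

Definition qtwist (rho : L -> L) f : qpoly_ring := map_mx rho f.

Definition permutation_qpoly f : Prop := bijective (qeval f).

Definition qrank f : nat := \dim (limg (linfun (qeval f))).

Definition rank_dist f g : nat := qrank (f - g).

Definition Fq_linear C : Prop :=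
  [/\ 0 \in C,
      forall f g, f \in C -> g \in C -> f + g \in C
    & forall (a : F) f, f \in C -> (a%:A : L) *: f \in C].

Definition min_distance C (d : nat) : Prop :=
  (exists f g, [/\ f \in C, g \in C, f != g & rank_dist f g = d])
  /\ (forall f g, f \in C -> g \in C -> f != g -> (d <= rank_dist f g)%N).

Definition MRD C (d : nat) : Prop :=
  min_distance C d /\ #|C| = (q ^ (n * (n - d + 1)))%N.

Definition left_idealiser C : {set qpoly_ring} :=
  [set phi | [forall f in C, qcomp phi f \in C]].

(* The set S, as a subring of the q-polynomials with addition and             *)
(* composition, is isomorphic to the field L.                                 *)
Definition ring_isomorphic_to_field (S : {set qpoly_ring}) : Prop :=
  exists psi : L -> qpoly_ring,
    [/\ injective psi,
        psi @: [set: L] = S,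
        {morph psi : a b / a + b},
        {morph psi : a b / a * b >-> qcomp a b}
      & psi 1 = qmonom 0].

Definition code_equivalent (C1 C2 : {set qpoly_ring}) : Prop :=
  exists (phi1 phi2 : qpoly_ring) (rho : {rmorphism L -> L}),
    [/\ permutation_qpoly phi1, permutation_qpoly phi2, bijective rho
      & forall f, f \in C1 -> qcomp (qcomp phi1 (qtwist rho f)) phi2 \in C2].

Definition code_of f : {set qpoly_ring} :=
  [set h | h \in <<[:: qmonom 0; f]>>%VS].

Definition graph_space f : {vspace (L * L)%type} :=
  limg (linfun (fun x : L => (x, qeval f x))).

Definition point_space (u : L * L) : {vspace (L * L)%type} :=
  limg (linfun (fun a : L => (a * u.1, a * u.2))).

Definition maximum_scattered f : Prop :=
  forall u : L * L, u \in graph_space f -> u != 0 ->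
    \dim (graph_space f :&: point_space u)%VS = 1%N.

End QPolynomials.

Section QPolynomialFacts.

Variables (F : finFieldType) (K : fieldExtType F) (n : nat).
Local Notation q := #|F|.
Local Notation L := (finvect_type K).
Implicit Types (f g : qpoly_ring K n).

Lemma card_pchar_nat (R : comNzRingType) (phi : {rmorphism F -> R}) i :
  [pchar R].-nat (q ^ i)%N.
Proof.
have [p p_pr charFp] := finPcharP F.
have charR := rmorph_pchar phi charFp.
rewrite (eq_pnat _ (pcharf_eq charR)).
rewrite pnatX; apply/orP; left.
have := card_pprimeChar charFp.
rewrite (_ : #|_| = q) // => ->.
by rewrite pnatX pnat_id.
Qed.

Lemma qpow_sum (R : comNzRingType) (phi : {rmorphism F -> R}) i m (E : 'I_m -> R) :
  (\sum_j E j) ^+ (q ^ i) = \sum_j E j ^+ (q ^ i).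
Proof.
elim/big_rec2: _ => [|j y1 y2 _ <-].
  by rewrite expr0n expn_eq0 (gtn_eqF (ltnW (finNzRing_gt1 F))).
by rewrite exprDn_pchar // card_pchar_nat.
Qed.

Lemma qevalE f (x : L) : qeval f x = \sum_(i < n) f 0 i * x ^+ (q ^ i).
Proof.
rewrite /qeval /qpoly_of horner_sum; apply: eq_bigr => i _.
by rewrite hornerZ hornerXn.
Qed.

Lemma qeval_is_linear f : linear (qeval f : L -> L).
Proof.
move=> a x y; rewrite !qevalE scaler_sumr -big_split /=.
apply: eq_bigr => i _.
rewrite exprDn_pchar ?(card_pchar_nat (in_alg L)) // exprZn mulrDr -scalerAr.
congr (_ *: _ + _).
by elim: (i : nat) => // m IH; rewrite expnSr exprM IH expf_card.
Qed.

HB.instance Definition _ f :=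
  GRing.isLinear.Build F L L *:%R (qeval f) (qeval_is_linear f).

Hypothesis dimK : \dim {:K} = n.

Lemma cardL : #|{: L}| = (q ^ n)%N.
Proof. by rewrite -dimK; have := card_vspace (fullv : {vspace L}); rewrite card_vspacef. Qed.

Lemma modpXq m : 'X^(q ^ m) %% ('X^(q ^ n) - 'X) = 'X^(q ^ (m %% n)%N) :> {poly L}.
Proof.
have n0 : (0 < n)%N by rewrite -dimK adim_gt0.
have q1 := finNzRing_gt1 F.
have szd : size ('X^(q ^ n) - 'X : {poly L}) = (q ^ n).+1.
  rewrite size_polyDl ?size_polyXn // size_polyN size_polyX.
  exact: (leq_trans q1 (leq_pexp2l (ltnW q1) n0)).
have [k ->] : exists k, m = (k * n + m %% n)%N by exists (m %/ n)%N; exact: divn_eq.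
have lt_r := ltn_pmod m n0; set r := (m %% n)%N in lt_r *.
rewrite modnMDl modn_small //.
elim: k => [|k IH].
  by rewrite modp_small // szd size_polyXn !ltnS ltn_exp2l.
rewrite mulSn -addnA expnD exprM -{}IH; set e := (q ^ (k * n + r))%N.
rewrite -[X in X ^+ e](subrK 'X).
rewrite /e exprDn_pchar; last exact: (card_pchar_nat (polyC \o in_alg L)).
rewrite modpD [X in X + _](_ : _ = 0) ?add0r //.
by apply/eqP/dvdp_exp => //; rewrite expn_gt0 ltnW.
Qed.

Lemma qpoly_of_comp f g :
  qpoly_of (qcomp f g) = (qpoly_of f \Po qpoly_of g) %% ('X^(q ^ n) - 'X).
Proof.
have n0 : (0 < n)%N by rewrite -dimK adim_gt0.
have q1 := finNzRing_gt1 F.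
pose P := \sum_(i < n) \sum_(j < n) (f 0 i * g 0 j ^+ (q ^ i)) *: 'X^(q ^ ((i + j) %% n)%N) : {poly L}.
have EP : (qpoly_of f \Po qpoly_of g) %% ('X^(q ^ n) - 'X) = P.
  rewrite {1}/qpoly_of raddf_sum /= (big_morph _ (fun x y => modpD _ x y) (mod0p _)).
  apply: eq_bigr => i _; rewrite comp_polyZ comp_Xn_poly /qpoly_of.
  rewrite (qpow_sum (polyC \o in_alg L)) scaler_sumr.
  rewrite (big_morph _ (fun x y => modpD _ x y) (mod0p _)).
  apply: eq_bigr => j _; rewrite exprZn -exprM -expnD scalerA modpZl modpXq.
  by rewrite addnC.
have Pq : P = \sum_(k < n) (\sum_(i < n) \sum_(j < n | ((i + j) %% n)%N == k)
    f 0 i * g 0 j ^+ (q ^ i)) *: 'X^(q ^ k).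
  under [RHS]eq_bigr do rewrite scaler_suml.
  rewrite exchange_big; apply: eq_bigr => i _ /=.
  under [RHS]eq_bigr do rewrite scaler_suml big_mkcond.
  rewrite exchange_big; apply: eq_bigr => j _ /=.
  rewrite (bigD1 (Ordinal (ltn_pmod (i + j) n0))) //= eqxx.
  by rewrite big1 ?addr0 // => k /negPf; rewrite -val_eqE /= eq_sym => ->.
rewrite EP [RHS]Pq /qpoly_of; apply: eq_bigr => k _; congr (_ *: _).
rewrite mxE EP Pq coef_sum (bigD1 k) //= coefZ coefXn eqxx mulr1.
rewrite [X in _ + X]big1 ?addr0 // => k' neq; rewrite coefZ coefXn eqn_exp2l //.
by move: neq; rewrite -val_eqE /= eq_sym => /negPf ->; rewrite mulr0.
Qed.

Lemma qeval_comp f g x : qeval (qcomp f g) x = qeval f (qeval g x).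
Proof.
rewrite /qeval qpoly_of_comp -horner_comp [in RHS](divp_eq (_ \Po _) ('X^(q ^ n) - 'X)).
by rewrite hornerD hornerM !hornerE -cardL expf_card subrr mulr0 add0r.
Qed.

End QPolynomialFacts.

(* Main.v *)
(* Let s be the q-Frobenius, f = s - s^2 + s^4 + s^5 and split x = a + b, up  *)
(* to a factor 2, into its s^3-invariant and s^3-anti-invariant parts. Then   *)
(* f x = s a - s^2 b, so [f x = m x] becomes a small system in a and b over   *)
(* the decomposition m = m0 + m1, and in the generic case m0, m1 != 0         *)
(* eliminating b leaves a second-order s-equation for a whose outer           *)
(* coefficients are s C and C, with C = m0 / m1 anti-invariant. If W is the   *)
(* Wronskian a1 s(a2) - a2 s(a1) of two solutions, C W is fixed by s, yet W   *)
(* is s^3-invariant, so W = 0 and the solutions are F_q-proportional. The     *)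
(* case m0 = 0 is where -1 must be a square in F_q.                           *)
(*   For inequivalence, any equivalence has a monomial c s^k as left factor   *)
(* (both codes are left F_(q^6)-spaces and the left idealiser of <x, f>       *)
(* consists of scalars), and s^k normalises <x, f>; hence f o psi lies        *)
(* in C_g for some nonzero psi in C_g, and comparing a few coefficients       *)
(* forces psi = 0.                                                            *)
Require Import Defs.
From HB Require Import structures.
From mathcomp Require Import all_boot all_order all_fingroup all_algebra.
From mathcomp Require Import all_solvable all_field.
From mathcomp Require Import ring.

Set Implicit Arguments.
Unset Strict Implicit.
Unset Printing Implicit Defensive.

Import GRing.Theory.
Local Open Scope ring_scope.

(** The MRD property is a kernel bound. A nonzero element [a x + b f] of the code is either
    invertible or has [b != 0], and its kernel is then the solution space of [f x = m x] with
    [m = - a / b]. By [scattered_eigen] this space is at most an F_q-line, so ranks are at least 5;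
    the element [f - 2 x] kills 1, so 5 is attained. [scat_scale_closed] makes left idealisers
    scalar and, through [scat_semilinear_comp], forces the left factor of an equivalence to be a
    monomial. What remains is one coefficient system for each family. The conditions on [q] enter
    through fields only: [q = 1 mod 4] gives odd characteristic and a square root of -1 in F_q,
    while [q <= 17] and [q <> 5] exclude characteristic 5, where the last family's determinant could
    vanish. *)

Lemma eq_oppr0 (L : fieldType) (x : L) : 2 != 0 :> L -> x = - x -> x = 0.
Proof.
move=> two_neq0 /eqP; rewrite -subr_eq0 opprK -mulr2n -mulr_natl mulf_eq0.
by rewrite (negPf two_neq0) => /eqP.
Qed.

(** * The eigenvalue equation [f x = m x] over an abstract field with [s ^ 6 = 1] *)

Section Scattered.

Variables (L : fieldType) (s : {rmorphism L -> L}).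
Hypothesis s6 : forall x : L, s (s (s (s (s (s x))))) = x.
Hypothesis two_neq0 : 2 != 0 :> L.
Variable im : L.
Hypotheses (im2 : im ^+ 2 = -1) (s_im : s im = im).

Local Notation f x := (s x - s (s x) + s (s (s (s x))) + s (s (s (s (s x))))).

Definition fixed_part (x : L) : L := x + s (s (s x)).
Definition anti_part (x : L) : L := x - s (s (s x)).

Lemma tau_fixed_part (x : L) : s (s (s (fixed_part x))) = fixed_part x.
Proof. by rewrite /fixed_part !rmorphD s6 addrC. Qed.

Lemma tau_anti_part (x : L) : s (s (s (anti_part x))) = - anti_part x.
Proof. by rewrite /anti_part !rmorphB s6 opprB. Qed.

Lemma add_parts (x : L) : fixed_part x + anti_part x = 2 * x.
Proof. rewrite /fixed_part /anti_part; ring. Qed.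

Lemma two_mul_eq0 (z : L) : (2 * z == 0) = (z == 0).
Proof. by rewrite mulf_eq0 (negPf two_neq0). Qed.

(** As [s^4 x] and [s^5 x] are [s] and [s^2] of [s^3 x], one has [f x = s a - s^2 b] with [a], [b]
    the two parts of [x]. Adding and subtracting the image of the equation under [s^3] separates
    [s a] from [s^2 b]. *)
Lemma eigen_parts (m x : L) : f x = m * x ->
  4 * s (fixed_part x) = fixed_part m * fixed_part x + anti_part m * anti_part x /\
  4 * s (s (anti_part x)) = - (anti_part m * fixed_part x + fixed_part m * anti_part x).
Proof.
move=> fx; have := congr1 (fun y => s (s (s y))) fx.
rewrite /= !(rmorphD, rmorphN, rmorphM) /= !s6 => tfx.
split; rewrite /fixed_part /anti_part.
  transitivity (2 * (m * x + s (s (s m)) * s (s (s x)))); last by ring.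
  by rewrite -fx -tfx; ring.
transitivity (- (2 * (m * x - s (s (s m)) * s (s (s x))))); last by ring.
by rewrite -fx -tfx; ring.
Qed.

(* The solution set of [f x = m x] is closed under [s]-fixed scalars, so the  *)
(* conclusion says that it is at most a line over the fixed field of [s].     *)
Lemma scattered_eigen (m x y : L) : x != 0 -> f x = m * x -> f y = m * y ->
  s (y / x) = y / x.
Proof.
move=> x0 /eigen_parts[]; set a := fixed_part x; set b := anti_part x => a_x b_x.
move=> /eigen_parts[]; set c := fixed_part y; set d := anti_part y => a_y b_y.
have [ta tc] : s (s (s a)) = a /\ s (s (s c)) = c by rewrite !tau_fixed_part.
have [tb td] : s (s (s b)) = - b /\ s (s (s d)) = - d by rewrite !tau_anti_part.
have four0 : 4 != 0 :> L by rewrite (_ : 4 = 2 * 2) ?mulf_neq0 //; ring.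
pose m0 := fixed_part m / 4; pose m1 := anti_part m / 4.
have tm0 : s (s (s m0)) = m0.
  by rewrite /m0 !fmorph_div /= tau_fixed_part !rmorph_nat.
have tm1 : s (s (s m1)) = - m1.
  by rewrite /m1 !fmorph_div /= tau_anti_part !rmorph_nat mulNr.
have {}a_x : s a = m0 * a + m1 * b.
  by apply: (mulfI four0); rewrite a_x /m0 /m1; field.
have {}a_y : s c = m0 * c + m1 * d.
  by apply: (mulfI four0); rewrite a_y /m0 /m1; field.
have {}b_x : s (s b) = - (m1 * a + m0 * b).
  by apply: (mulfI four0); rewrite b_x /m0 /m1; field.
have {}b_y : s (s d) = - (m1 * c + m0 * d).
  by apply: (mulfI four0); rewrite b_y /m0 /m1; field.
have xE : a + b = 2 * x := add_parts x.
have yE : c + d = 2 * y := add_parts y.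
clearbody a b c d m0 m1.
suff [l sl [lc ld]] : exists2 l, s l = l & c = l * a /\ d = l * b.
  suff -> : y / x = l by [].
  apply: (canLR (mulfK x0)); apply: (mulfI two_neq0).
  by rewrite -yE lc ld mulrCA -xE mulrDr.
(* For [m1 = 0] the system decouples: a nonzero invariant part forces [m0 * s m0 * s (s m0)] to be
   1, a nonzero anti-invariant part forces -1. So only one kind of part occurs, for both
   solutions. *)
have [m1_0|m1_neq0] := eqVneq m1 0.
  rewrite m1_0 !(mul0r, addr0, add0r) in a_x a_y b_x b_y.
  have norm_a z : z != 0 -> s z = m0 * z -> s (s (s z)) = z ->
      m0 * s m0 * s (s m0) = 1.
    move=> z0 sz tz; apply: (mulIf z0).
    by rewrite mul1r -[RHS]tz !(sz, rmorphM); ring.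
  have norm_b z : z != 0 -> s (s z) = - (m0 * z) ->
      m0 * s m0 * s (s m0) = -1.
    move=> z0 sz; apply: (mulIf z0).
    rewrite -[in RHS](s6 z) !(sz, rmorphM, rmorphN) /= tm0; ring.
  have one_neqN1 : 1 <> -1 :> L.
    by move=> /(eq_oppr0 two_neq0)/eqP; rewrite oner_eq0.
  have [a0|a_neq0] := eqVneq a 0.
    have b_neq0 : b != 0.
      by apply: contraNneq x0 => b0; rewrite -two_mul_eq0 -xE a0 b0 addr0.
    have c0 : c = 0.
      apply/eqP/negPn/negP=> c_neq0; apply: one_neqN1.
      by rewrite -[LHS](norm_a c) ?(norm_b b).
    (* The ratio is also fixed by [s^3], being a quotient of two anti-invariant elements, hence it
       is fixed by [s]. *)
    have s2 : s (s (d / b)) = d / b.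
      rewrite !fmorph_div b_x b_y !invrN !mulNr mulrN opprK.
      have m0_neq0 : m0 != 0.
        apply: contraNneq b_neq0 => m00.
        by rewrite -[b]s6 b_x m00 mul0r oppr0 !rmorph0.
      by field; rewrite ?b_neq0 ?m0_neq0.
    exists (d / b); last by rewrite a0 c0 mulr0 divfK.
    by rewrite -[X in s X]s2 !fmorph_div tb td invrN mulrNN.
  have b0 : b = 0.
    apply/eqP/negPn/negP=> b_neq0; apply: one_neqN1.
    by rewrite -[LHS](norm_a a) ?(norm_b b).
  have d0 : d = 0.
    apply/eqP/negPn/negP=> d_neq0; apply: one_neqN1.
    by rewrite -[LHS](norm_a a) ?(norm_b d).
  exists (c / a); last by rewrite b0 d0 mulr0 divfK.
  have m0_neq0 : m0 != 0.
    apply: contraNneq a_neq0 => m00.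
    by rewrite -[a]s6 a_x m00 mul0r !rmorph0.
  by rewrite fmorph_div a_x a_y; field; rewrite ?a_neq0 ?m0_neq0.
have bE : b = (s a - m0 * a) / m1 by rewrite a_x; field.
have dE : d = (s c - m0 * c) / m1 by rewrite a_y; field.
have a_neq0 : a != 0.
  apply: contraNneq x0 => a0; rewrite -two_mul_eq0 -xE.
  by rewrite bE a0 rmorph0 mulr0 subrr mul0r addr0.
(* This is [s] applied to the formula for [s (s b)], with [s^3 b = - b]. *)
have sb : b = s m1 * s a + s m0 * s b.
  by apply: oppr_inj; rewrite -tb b_x !(rmorphN, rmorphD, rmorphM).
have sd : d = s m1 * s c + s m0 * s d.
  by apply: oppr_inj; rewrite -td b_y !(rmorphN, rmorphD, rmorphM).
have sm1_neq0 : s m1 != 0 by rewrite fmorph_eq0.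
pose W := a * s c - c * s a.
suff W0 : W = 0.
  have scE : s (c / a) = c / a.
    rewrite fmorph_div; apply/eqP; rewrite eqr_div ?fmorph_eq0 // mulrC -subr_eq0.
    by rewrite -/W W0.
  exists (c / a) => //; rewrite divfK //; split => //.
  by rewrite dE bE -[c in s c](divfK a_neq0) rmorphM scE; field; rewrite m1_neq0.
(* For [m0 = 0], [m1] is fixed by [s^2] and negated by [s^3], so [s m1 = - m1] and [m1 ^+ 2 = -1].
   Then [m1] is [im] or [- im], fixed by [s]: a contradiction. *)
have [m00|m0_neq0] := eqVneq m0 0.
  rewrite m00 rmorph0 !mul0r addr0 add0r in sb a_x.
  have m11 : s m1 * m1 = 1.
    have b_neq0 : b != 0.
      by apply: contraNneq a_neq0 => b0; rewrite -[a]s6 a_x b0 mulr0 !rmorph0.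
    by apply: (mulIf b_neq0); rewrite mul1r -mulrA -a_x -sb.
  have s2m1 : s (s m1) = m1.
    by apply: (mulIf sm1_neq0); rewrite [RHS]mulrC m11 -rmorphM m11 rmorph1.
  have m1sq : m1 ^+ 2 = im ^+ 2.
    apply: oppr_inj; rewrite im2 opprK -m11.
    by rewrite -[X in s X]s2m1 tm1; ring.
  have tim : s (s (s m1)) = m1.
    by move/eqP: m1sq; rewrite eqf_sqr => /orP[]/eqP->; rewrite ?rmorphN !s_im.
  by case/eqP: m1_neq0; apply: (eq_oppr0 two_neq0); rewrite -tm1 tim.
(* Eliminating [b] gives [s C * s^2 a + B * s a + C * a = 0], [C = m0 / m1];  *)
(* for two solutions the term in [B] cancels, and [C * W] is fixed by [s].    *)
have lin z w : w = (s z - m0 * z) / m1 -> w = s m1 * s z + s m0 * s w ->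
    s (m0 / m1) * s (s z) + m0 / m1 * z =
    (m1^-1 - s m1 + s m0 * s m0 / s m1) * s z.
  move=> wE h; have sw : s w = (s (s z) - s m0 * s z) / s m1.
    by rewrite wE fmorph_div rmorphB rmorphM.
  rewrite sw {1}wE in h; apply: subr0_eq; rewrite fmorph_div.
  rewrite -[RHS](subrr ((s z - m0 * z) / m1)) {1}h.
  by field; rewrite ?m1_neq0 ?sm1_neq0.
have la := lin a b bE sb; have lc := lin c d dE sd.
have CW : s (m0 / m1 * W) = m0 / m1 * W.
  rewrite rmorphM {2}/W rmorphB !rmorphM.
  apply/eqP; rewrite -subr_eq0; apply/eqP.
  transitivity (s a * (s (m0 / m1) * s (s c) + m0 / m1 * c)
    - s c * (s (m0 / m1) * s (s a) + m0 / m1 * a)); first by rewrite /W; ring.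
  by rewrite la lc; ring.
have tW : s (s (s W)) = W by rewrite /W !(rmorphB, rmorphM) ta tc.
have : m0 / m1 * W = - (m0 / m1 * W).
  rewrite -{1}CW -{1}CW -{1}CW !(rmorphM, fmorphV) tW.
  by rewrite tm0 tm1 invrN mulrN mulNr.
move/(eq_oppr0 two_neq0)/eqP.
by rewrite !mulf_eq0 invr_eq0 (negPf m0_neq0) (negPf m1_neq0) => /eqP.
Qed.

End Scattered.

(** * The q-Frobenius as a ring morphism *)

Section Frobenius.

Variables (F : finFieldType) (K : fieldExtType F).
Local Notation q := #|F|.
Local Notation L := (finvect_type K).

Definition frob (x : L) : L := x ^+ q.

Lemma frob_is_zmod_morphism : zmod_morphism frob.
Proof.
have qL : [pchar L].-nat q.
  by rewrite -[q]expn1; exact: (card_pchar_nat (in_alg L)).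
have frobD x y : frob (x + y) = frob x + frob y by rewrite /frob exprDn_pchar.
move=> x y; apply: (canRL (addrK (frob y))).
by rewrite -frobD subrK.
Qed.

Lemma frob_is_monoid_morphism : monoid_morphism frob.
Proof. by split=> [|x y]; rewrite /frob ?expr1n ?exprMn. Qed.

HB.instance Definition _ :=
  GRing.isZmodMorphism.Build L L frob frob_is_zmod_morphism.
HB.instance Definition _ :=
  GRing.isMonoidMorphism.Build L L frob frob_is_monoid_morphism.

Lemma iter_frob i x : x ^+ (q ^ i) = iter i frob x.
Proof. by elim: i => [|i IH]; rewrite ?expr1 // expnSr exprM IH. Qed.

(** [X^q - X] is the product of the [X - a] for [a] in F, so it has no other root in L. *)
Lemma frob_fixed x : frob x = x -> exists a : F, x = a%:A.
Proof.
move=> fx; have := congr1 (fun p : {poly F} => (map_poly (in_alg L) p).[x])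
  (finField_genPoly F).
rewrite rmorphB rmorph_prod /= map_polyXn map_polyX !hornerE.
rewrite -/(frob x) fx subrr horner_prod => /esym/eqP; rewrite prodf_seq_eq0.
move=> /hasP[a _ /=]; rewrite rmorphB /= map_polyX map_polyC !hornerE subr_eq0.
by move=> /eqP; exists a.
Qed.

Hypothesis dimK : \dim {:K} = 6%N.

Lemma frob6 x : frob (frob (frob (frob (frob (frob x))))) = x.
Proof.
have := expf_card x; rewrite (cardL dimK) => {2}<-.
by rewrite iter_frob.
Qed.

End Frobenius.

(** * q-polynomials as maps, and the codes [<x, f>] *)

Section Qpolynomials.

Variables (F : finFieldType) (K : fieldExtType F) (n : nat).
Hypothesis dimK : \dim {:K} = n.
Local Notation q := #|F|.
Local Notation L := (finvect_type K).
Implicit Types f g h : qpoly_ring K n.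

(** The reduced representative has degree below [q ^ n], the number of its roots in L. *)
Lemma qeval_eq0 f : (forall x, qeval f x = 0) -> f = 0.
Proof.
move=> f0; have n0 : (0 < n)%N by rewrite -dimK adim_gt0.
have q1 := finNzRing_gt1 F.
have szf : (size (qpoly_of f) <= q ^ n)%N.
  apply: leq_trans (size_sum _ _ _) _; apply/bigmax_leqP => i _.
  apply: leq_trans (size_scale_leq _ _) _.
  by rewrite size_polyXn ltn_exp2l.
have p0 : qpoly_of f = 0.
  apply: (@roots_geq_poly_eq0 _ _ (enum L)).
  - by apply/allP => x _; apply/eqP; exact: f0.
  - exact: enum_uniq.
  - by rewrite -cardE (cardL dimK).
apply/rowP => i; rewrite mxE; have := congr1 (fun p : {poly L} => p`_(q ^ i)) p0.
rewrite coef0 coef_sum (bigD1 i) //= coefZ coefXn eqxx mulr1 big1 ?addr0 //.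
move=> j neq; rewrite coefZ coefXn eqn_exp2l // eq_sym (inj_eq val_inj).
by rewrite (negPf neq) mulr0.
Qed.

Lemma qevalB f g x : qeval (f - g) x = qeval f x - qeval g x.
Proof.
by rewrite !qevalE -sumrB; apply: eq_bigr => i _; rewrite !mxE mulrBl.
Qed.

Lemma qevalD f g x : qeval (f + g) x = qeval f x + qeval g x.
Proof.
by rewrite !qevalE -big_split; apply: eq_bigr => i _; rewrite !mxE mulrDl.
Qed.

Lemma qevalZ (a : L) f x : qeval (a *: f) x = a * qeval f x.
Proof.
by rewrite !qevalE mulr_sumr; apply: eq_bigr => i _; rewrite !mxE mulrA.
Qed.

Lemma qeval_inj f g : qeval f =1 qeval g -> f = g.
Proof.
move=> fg; apply: subr0_eq; apply: qeval_eq0 => x.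
by rewrite qevalB fg subrr.
Qed.

Lemma qeval_monom i x : (i < n)%N -> qeval (qmonom K n i) x = iter i (@frob F K) x.
Proof.
move=> ltin; rewrite qevalE (bigD1 (Ordinal ltin)) //= !mxE eqxx mul1r.
rewrite big1 ?addr0 ?iter_frob // => j neq; rewrite mxE.
by rewrite -(inj_eq val_inj) in neq; rewrite (negPf neq) mul0r.
Qed.

Lemma code_ofP f h :
  reflect (exists a b, h = a *: qmonom K n 0 + b *: f) (h \in code_of f).
Proof.
rewrite inE span_cons span_seq1.
apply: (iffP memv_addP) => [[u /vlineP[a ->] [v /vlineP[b ->] ->]]|[a [b ->]]].
  by exists a, b.
exists (a *: qmonom K n 0); first exact: memvZ (memv_line _).
by exists (b *: f) => //; exact: memvZ (memv_line _).
Qed.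

Lemma Fq_linear_code_of f : Fq_linear (code_of f).
Proof.
split; first by rewrite inE mem0v.
- by move=> g h; rewrite !inE; exact: memvD.
- by move=> a g; rewrite !inE; exact: memvZ.
Qed.

Lemma code_of_qevalP f h : (0 < n)%N ->
  reflect (exists a b, forall x, qeval h x = a * x + b * qeval f x)
    (h \in code_of f).
Proof.
move=> n0; apply: (iffP (code_ofP f h)) => -[a [b hE]]; exists a, b.
  by move=> x; rewrite hE qevalD !qevalZ qeval_monom.
by apply: qeval_inj => x; rewrite hE qevalD !qevalZ qeval_monom.
Qed.

Lemma code_ofE f :
  code_of f = [set p.1 *: qmonom K n 0 + p.2 *: f | p : L * L].
Proof.
apply/setP => h; apply/code_ofP/imsetP => [[a [b ->]]|[[a b] _ ->]].
  by exists (a, b).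
by exists a, b.
Qed.

Lemma card_code_of_le f : (#|code_of f| <= #|{: L * L}|)%N.
Proof. by rewrite code_ofE leq_imset_card. Qed.

End Qpolynomials.

(** * The code of [scat] and its left idealiser *)

Section Degree6.

Variables (F : finFieldType) (K : fieldExtType F).
Hypothesis dimK : \dim {:K} = 6%N.
Local Notation q := #|F|.
Local Notation L := (finvect_type K).
Local Notation s := (@frob F K).
Local Notation x_ i := (qmonom K 6 i%N).
Implicit Types (g h : qpoly_ring K 6).

Lemma qeval6E g x : qeval g x = g 0 0 * x + g 0 1 * s x + g 0 2 * s (s x)
  + g 0 3 * s (s (s x)) + g 0 4 * s (s (s (s x)))
  + g 0 5 * s (s (s (s (s x)))).
Proof.
rewrite qevalE !big_ord_recl big_ord0 !iter_frob /= addr0 !addrA.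
by do ![congr (_ + _)]; congr (g _ _ * _); apply: val_inj.
Qed.

Lemma frob_lin_indep (c0 c1 c2 c3 c4 c5 : L) :
  (forall x, c0 * x + c1 * s x + c2 * s (s x) + c3 * s (s (s x))
     + c4 * s (s (s (s x))) + c5 * s (s (s (s (s x)))) = 0) ->
  [/\ c0 = 0, c1 = 0, c2 = 0, c3 = 0 & c4 = 0 /\ c5 = 0].
Proof.
move=> c_eq0; pose g : qpoly_ring K 6 := \row_i [:: c0; c1; c2; c3; c4; c5]`_i.
have g0 : g = 0 by apply: (qeval_eq0 dimK) => x; rewrite qeval6E !mxE c_eq0.
have gi (i : 'I_6) : [:: c0; c1; c2; c3; c4; c5]`_i = 0.
  by have /rowP/(_ i) := g0; rewrite !mxE.
by split; [apply: (gi 0)|apply: (gi 1)|apply: (gi 2)|apply: (gi 3)|split;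
  [apply: (gi 4)|apply: (gi 5)]].
Qed.

Definition scat (x : L) : L :=
  s x - s (s x) + s (s (s (s x))) + s (s (s (s (s x)))).

Definition scat_qpoly : qpoly_ring K 6 := x_ 1 - x_ 2 + x_ 4 + x_ 5.

Local Notation C := (code_of scat_qpoly).

Lemma qeval_scat x : qeval scat_qpoly x = scat x.
Proof. by rewrite /scat_qpoly 2!qevalD qevalB !qeval_monom. Qed.

Lemma scat_indep (a b : L) : (forall x, a * x + b * scat x = 0) -> a = 0 /\ b = 0.
Proof.
move=> ab0; have [] // := @frob_lin_indep a b (- b) 0 b b.
by move=> x; rewrite -[RHS](ab0 x) /scat; ring.
Qed.

(** Comparing the coefficients of [s] and [s^2] gives [b * s c = e = b * s (s c)]. If [b != 0], then
    [s] and [s^2] agree on all of L, against their independence. *)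
Lemma scat_scale_closed (b : L) :
  (forall c : L, exists d e, forall x, b * scat (c * x) = d * x + e * scat x) -> b = 0.
Proof.
move=> bscat; apply/eqP/negPn/negP => b0.
have s12 c : s c = s (s c).
  have [d [e bE]] := bscat c.
  have [|_ e1 e2 _ _] := @frob_lin_indep (- d) (b * s c - e) (e - b * s (s c)) 0
     (b * s (s (s (s c))) - e) (b * s (s (s (s (s c)))) - e).
    move=> x; rewrite -[RHS](subrr (b * scat (c * x))) {2}bE /scat !rmorphM; ring.
  apply: (mulfI b0); apply/eqP; rewrite -subr_eq0.
  by rewrite -[X in _ == X](addr0 0) -{1}e1 -e2; apply/eqP; ring.
have [|_ /eqP] := @frob_lin_indep 0 1 (-1) 0 0 0; last by rewrite oner_eq0.
by move=> x; rewrite -s12; ring.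
Qed.

Lemma left_idealiser_scat : left_idealiser C = [set a *: x_ 0 | a : L].
Proof.
apply/setP => phi; rewrite inE; apply/forall_inP/imsetP => [phiC | [a _ ->] h].
  have phiE h : h \in C ->
      exists d e, forall x, qeval phi (qeval h x) = d * x + e * scat x.
    move=> /phiC /(code_of_qevalP dimK)[//|d [e hE]]; exists d, e => x.
    by rewrite -(qeval_comp dimK) hE qeval_scat.
  have x0C (c : L) : c *: x_ 0 \in C.
    by apply/code_ofP; exists c, 0; rewrite scale0r addr0.
  (* Since [x] is in the code, [phi] itself is; testing [phi] on [c x] then removes its [scat]
     component. *)
  have [a [b phi_ab]] := phiE _ (x0C 1).
  have {}phi_ab x : qeval phi x = a * x + b * scat x.
    by rewrite -phi_ab qevalZ qeval_monom // mul1r.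
  have b0 : b = 0.
    apply: scat_scale_closed => c; have [d [e phi_de]] := phiE _ (x0C c).
    exists (d - a * c), e => x; have := phi_de x.
    rewrite qevalZ qeval_monom //= phi_ab => /(canRL (addKr _)) ->; ring.
  exists a => //; apply: (qeval_inj dimK) => x.
  by rewrite phi_ab b0 qevalZ qeval_monom // mul0r addr0.
move=> /(code_of_qevalP dimK)[//|c [d hE]].
apply/(code_of_qevalP dimK) => //; exists (a * c), (a * d) => x.
by rewrite (qeval_comp dimK) qevalZ qeval_monom //= hE mulrDr !mulrA.
Qed.

Lemma left_idealiser_scat_field : ring_isomorphic_to_field (left_idealiser C).
Proof.
have x00 : x_ 0 0 0 = 1 by rewrite mxE.
exists (fun a : L => a *: x_ 0); split.
- by move=> a b /(congr1 (fun g : qpoly_ring K 6 => g 0 0)); rewrite !mxE !mulr1.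
- rewrite left_idealiser_scat; apply/setP => h.
  by apply/imsetP/imsetP => -[a _ ->]; exists a.
- by move=> a b; rewrite scalerDl.
- move=> a b; apply: (qeval_inj dimK) => x.
  by rewrite (qeval_comp dimK) !qevalZ !qeval_monom //= mulrA.
- by rewrite scale1r.
Qed.

Lemma dim_ker_qeval h : (qrank h + \dim (lker (linfun (qeval h))) = 6)%N.
Proof.
rewrite -[RHS]dimK -(limg_ker_dim (linfun (qeval h)) fullv) capfv addnC.
by [].
Qed.

Lemma card_code_scat : #|C| = #|{: L * L}|.
Proof.
rewrite code_ofE card_imset // => -[a b] [c d] /= /eqP.
rewrite -subr_eq0 => /eqP abcd.
have [|/subr0_eq-> /subr0_eq->//] := scat_indep (a := a - c) (b := b - d).
move=> x; rewrite -qeval_scat -[x in (a - c) * x](@qeval_monom _ _ 6 0) //.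
rewrite !mulrBl -!qevalZ addrACA -opprD -!qevalD -qevalB abcd.
by rewrite qevalE big1 // => i _; rewrite mxE mul0r.
Qed.

(** * Minimum distance *)

Section RankDistance.

Hypothesis two_neq0 : 2 != 0 :> L.
Variable im : L.
Hypotheses (im2 : im ^+ 2 = -1) (frob_im : s im = im).

Lemma qrank_scat h : h \in C -> h != 0 -> (5 <= qrank h)%N.
Proof.
move=> /(code_of_qevalP dimK)[//|a [b hE]] h0.
rewrite -(leq_add2r (\dim (lker (linfun (qeval h))))) (dim_ker_qeval).
rewrite addnC -[6%N]/(1 + 5)%N leq_add2r.
have [->|ker_neq0] := eqVneq (lker (linfun (qeval h))) 0%VS; first by rewrite dimv0.
set U := lker _ in ker_neq0 *; pose u := vpick U.
have u0 : u != 0 by rewrite vpick0.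
have kerE x : x \in U -> a * x + b * scat x = 0.
  by rewrite memv_ker lfunE /= hE qeval_scat => /eqP.
have b0 : b != 0.
  apply: contraNneq h0 => b0; apply/eqP/(qeval_eq0 dimK) => x.
  have /eqP := kerE u (memv_pick U); rewrite hE b0 !mul0r !addr0 mulf_eq0.
  by rewrite (negPf u0) orbF => /eqP->; rewrite mul0r.
have eigen x : x \in U -> scat x = - (a / b) * x.
  move=> /kerE/eqP; rewrite addrC addr_eq0 => /eqP ab; apply: (mulfI b0).
  by rewrite ab; field.
apply: leq_trans (_ : \dim <[u]> <= _)%N; last by rewrite dim_vline leq_b1.
apply: dimvS; apply/subvP => y /eigen yE.
have := scattered_eigen (frob6 dimK) two_neq0 im2 frob_im u0 (eigen u (memv_pick U)) yE.
move=> /frob_fixed[c cE]; apply/vlineP; exists c.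
by rewrite -[c *: u]mulr_algl -cE divfK.
Qed.

Lemma MRD_scat : MRD C 5.
Proof.
split; last first.
  by rewrite card_code_scat card_prod (cardL dimK) -expnD.
split; last first.
  move=> g h gC hC gh; apply: qrank_scat; last by rewrite subr_eq0.
  by move: gC hC; rewrite !inE; exact: memvB.
(* [scat 1 = 1 - 1 + 1 + 1 = 2], so 1 lies in the kernel of this codeword. *)
have scatC : scat_qpoly - 2 *: x_ 0 \in C.
  by apply/code_ofP; exists (- 2), 1; rewrite scale1r scaleNr addrC.
have scat_neq0 : scat_qpoly - 2 *: x_ 0 != 0.
  apply/eqP => /(congr1 (fun g : qpoly_ring K 6 => g 0 1)).
  rewrite !mxE /= mulr0 !subr0 !addr0 => /eqP; by rewrite oner_eq0.
exists (scat_qpoly - 2 *: x_ 0), 0; split=> //; first by rewrite inE mem0v.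
apply/eqP; rewrite eqn_leq /rank_dist subr0 qrank_scat // andbT.
rewrite -(leq_add2r (\dim (lker (linfun (qeval (scat_qpoly - 2 *: x_ 0)))))).
rewrite (dim_ker_qeval) -[6%N]/(5 + 1)%N leq_add2l.
rewrite lt0n dimv_eq0; apply/eqP => ker0.
have : (1 : L) \in lker (linfun (qeval (scat_qpoly - 2 *: x_ 0))).
  rewrite memv_ker lfunE /= qevalB qevalZ qeval_monom // qeval_scat /scat !rmorph1 /=.
  by apply/eqP; ring.
by rewrite ker0 memv0 oner_eq0.
Qed.

End RankDistance.

(** * Equivalences reduced to coefficient equations *)

Lemma scat_comp_coefs (p0 p1 p2 p3 p4 p5 r0 r1 r2 r3 r4 r5 : L) :
  (forall x,
    scat (p0 * x + p1 * s x + p2 * s (s x) + p3 * s (s (s x))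
       + p4 * s (s (s (s x))) + p5 * s (s (s (s (s x))))) =
    r0 * x + r1 * s x + r2 * s (s x) + r3 * s (s (s x))
       + r4 * s (s (s (s x))) + r5 * s (s (s (s (s x))))) ->
  [/\ s p1 - s (s p0) + s (s (s (s p4))) + s (s (s (s (s p3)))) = r2,
      s p2 - s (s p1) + s (s (s (s p5))) + s (s (s (s (s p4)))) = r3,
      s p3 - s (s p2) + s (s (s (s p0))) + s (s (s (s (s p5)))) = r4
    & s p4 - s (s p3) + s (s (s (s p1))) + s (s (s (s (s p0)))) = r5].
Proof.
move=> scatE; have [|_ _ /subr0_eq e2 /subr0_eq e3 [/subr0_eq e4 /subr0_eq e5]] :=
    @frob_lin_indep
  (s p5 - s (s p4) + s (s (s (s p2))) + s (s (s (s (s p1)))) - r0)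
  (s p0 - s (s p5) + s (s (s (s p3))) + s (s (s (s (s p2)))) - r1)
  (s p1 - s (s p0) + s (s (s (s p4))) + s (s (s (s (s p3)))) - r2)
  (s p2 - s (s p1) + s (s (s (s p5))) + s (s (s (s (s p4)))) - r3)
  (s p3 - s (s p2) + s (s (s (s p0))) + s (s (s (s (s p5)))) - r4)
  (s p4 - s (s p3) + s (s (s (s p1))) + s (s (s (s (s p0)))) - r5).
  move=> x; rewrite -[RHS](subrr (scat (p0 * x + p1 * s x + p2 * s (s x)
    + p3 * s (s (s x)) + p4 * s (s (s (s x))) + p5 * s (s (s (s (s x))))))).
  by rewrite {2}scatE /scat !(rmorphD, rmorphM) /= !(frob6 dimK); ring.
by split.
Qed.

Lemma scat_semilinear_comp g : code_equivalent C (code_of g) ->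
  exists a b c d : L, [/\ (a != 0) || (b != 0)
    & forall x, scat (a * x + b * qeval g x) = c * x + d * qeval g x].
Proof.
move=> [phi1 [phi2 [rho [bij1 bij2 bij_rho phiC]]]].
have inj1 := bij_inj bij1; have [P2' P2'K P2K] := bij2.
have twistE (a b : L) :
    qtwist rho (a *: x_ 0 + b *: scat_qpoly) = rho a *: x_ 0 + rho b *: scat_qpoly.
  apply/rowP => i; rewrite !mxE !(rmorphD, rmorphN, rmorphM) /=.
  by rewrite !rmorph_nat.
pose T (u : L * L) :=
  qcomp (qcomp phi1 (u.1 *: x_ 0 + u.2 *: scat_qpoly)) phi2.
have TE u x : qeval (T u) x =
    qeval phi1 (u.1 * qeval phi2 x + u.2 * scat (qeval phi2 x)).
  by rewrite !(qeval_comp dimK) qevalD !qevalZ qeval_monom // qeval_scat.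
have TC u : T u \in code_of g.
  (* [rho] fixes the coefficients of [scat_qpoly] and is onto, so the twist only reparametrises the
     code. *)
  have [rho' _ rhoK] := bij_rho; rewrite /T -(rhoK u.1) -(rhoK u.2) -twistE.
  by apply/phiC/code_ofP; do 2![eexists].
clearbody T; have T_inj : injective T.
  move=> [a b] [c d] Tabcd.
  have [|/subr0_eq-> /subr0_eq->//] := scat_indep (a := a - c) (b := b - d).
  move=> x; rewrite -(P2K x); apply/eqP; rewrite !mulrBl addrACA -opprD subr_eq0.
  by apply/eqP/inj1; rewrite -!(TE (_, _)) Tabcd.
(* [T] is injective and its target has at most as many elements as [L * L]. *)
have T_onto h : h \in code_of g -> exists u, T u = h.
  have /eqP TCE : T @: setT == code_of g.
    rewrite eqEcard card_imset // cardsT card_code_of_le andbT.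
    by apply/subsetP => _ /imsetP[u _ ->].
  by rewrite -TCE => /imsetP[u _ ->]; exists u.
(* The code of [g] is closed under left scalars; pulled back through [T], this closure says that
   scaling [phi1] on the left amounts to scaling its argument. *)
have scaleP1 al : exists a, forall x, al * qeval phi1 x = qeval phi1 (a * x).
  have scaleT v : exists u, forall x,
      al * qeval (T v) x = qeval (T u) x.
    have [|u uE] := T_onto (al *: T v); last by exists u => x; rewrite uE qevalZ.
    by have := TC v; rewrite !inE; exact: memvZ.
  have [[a b] abE] := scaleT (1, 0).
  have {}abE x : al * qeval phi1 x = qeval phi1 (a * x + b * scat x).
    by rewrite -(P2K x); have := abE (P2' x); rewrite !TE /= mul1r mul0r addr0.
  suff b0 : b = 0 by exists a => x; rewrite abE b0 mul0r addr0.
  apply: (scat_scale_closed) => c; have [[d e] deE] := scaleT (c, 0).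
  exists (d - a * c), e => x; have := deE (P2' x).
  rewrite !TE P2K /= mul0r addr0 abE => /inj1/(canRL (addKr _)) ->; ring.
have P1_neq0 : phi1 != 0.
  apply/eqP => phi10; case/eqP: (oner_neq0 L); apply: inj1.
  by rewrite phi10 !qevalE !big1 // => i _; rewrite mxE mul0r.
have [k phik] : exists k, phi1 0 k != 0 by apply/rV0Pn.
have iter_inj i : injective (iter i s).
  by elim: i => [|i IH] // x y /= /fmorph_inj/IH.
(* A nonzero coefficient of [phi1] at [i] forces [al = s^i a]; two such indices would give equal
   powers of [s]. *)
have phi1E x : qeval phi1 x = phi1 0 k * iter k s x.
  have coefE i a al : (forall y, al * qeval phi1 y = qeval phi1 (a * y)) ->
      phi1 0 i != 0 -> al = iter i s a.
    move=> aE phii.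
    have : al *: phi1 = \row_j (phi1 0 j * iter j s a).
      apply: (qeval_inj dimK) => y; rewrite qevalZ aE !qevalE.
      by apply: eq_bigr => j _; rewrite mxE exprMn !iter_frob mulrA.
    by move=> /rowP/(_ i); rewrite !mxE [RHS]mulrC => /(mulIf phii).
  rewrite qevalE (bigD1 k) //= big1 ?addr0 ?iter_frob // => j jk.
  have [->|phij] := eqVneq (phi1 0 j) 0; first by rewrite mul0r.
  have {}jk : (k == j :> nat) = false.
    by apply/negbTE; rewrite eq_sym (inj_eq val_inj).
  have : x_ j = x_ k.
    apply: (qeval_inj dimK) => y; rewrite !qeval_monom //.
    have [a aE] := scaleP1 (iter k s y).
    have /iter_inj ya := coefE k a _ aE phik.
    by rewrite (coefE j a _ aE phij) ya.
  by move=> /rowP/(_ k)/eqP; rewrite !mxE eqxx jk eq_sym oner_eq0.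
have iter_scat i y : iter i s (scat y) = scat (iter i s y).
  elim: i => //= i ->; by rewrite /scat !(rmorphD, rmorphN).
have T_coefs u : exists c d, forall x,
    iter k s (u.1 * qeval phi2 x + u.2 * scat (qeval phi2 x)) = c * x + d * qeval g x.
  have /(code_of_qevalP dimK)[//|c [d cdE]] := TC u.
  exists (c / phi1 0 k), (d / phi1 0 k) => x; apply: (mulfI phik).
  by rewrite -phi1E -TE cdE; field.
(* With [psi = s^k o phi2], these say that [psi] and [scat o psi = s^k o scat o phi2] both lie in
   the code of [g]. *)
have [a [b abE]] := T_coefs (1, 0); have [c [d cdE]] := T_coefs (0, 1).
exists a, b, c, d; split.
  rewrite -negb_and; apply/negP => /andP[/eqP a0 /eqP b0].
  case/eqP: (oner_neq0 L); apply: (bij_inj bij2); apply: (iter_inj k).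
  have := abE 1; have := abE 0.
  by rewrite /= !mul1r !mul0r !addr0 a0 b0 !mul0r !addr0 => -> ->.
move=> x; rewrite -abE -cdE /= mul1r !mul0r addr0 add0r mul1r.
by rewrite iter_scat.
Qed.

Lemma code_equivalent_coefs g : g 0 0 = 0 -> code_equivalent C (code_of g) ->
  exists a b d : L, [/\ (a != 0) || (b != 0),
    s (b * g 0 1) - s (s a) + s (s (s (s (b * g 0 4))))
      + s (s (s (s (s (b * g 0 3))))) = d * g 0 2,
    s (b * g 0 2) - s (s (b * g 0 1)) + s (s (s (s (b * g 0 5))))
      + s (s (s (s (s (b * g 0 4))))) = d * g 0 3,
    s (b * g 0 3) - s (s (b * g 0 2)) + s (s (s (s a)))
      + s (s (s (s (s (b * g 0 5))))) = d * g 0 4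
  & s (b * g 0 4) - s (s (b * g 0 3)) + s (s (s (s (b * g 0 1))))
      + s (s (s (s (s a)))) = d * g 0 5].
Proof.
move=> g0 /scat_semilinear_comp[a [b [c [d [ab_neq0 scatE]]]]].
exists a, b, d.
have [|e2 e3 e4 e5] := scat_comp_coefs (p0 := a) (p1 := b * g 0 1)
    (p2 := b * g 0 2) (p3 := b * g 0 3) (p4 := b * g 0 4) (p5 := b * g 0 5)
    (r0 := c) (r1 := d * g 0 1) (r2 := d * g 0 2) (r3 := d * g 0 3)
    (r4 := d * g 0 4) (r5 := d * g 0 5).
  move=> x; have := scatE x; rewrite qeval6E g0 mul0r add0r.
  by rewrite !mulrDr !mulrA !addrA.
by split.
Qed.

(** * The four excluded families *)

Lemma frob_eq0 (y : L) : s y = 0 -> y = 0.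
Proof. by move/eqP; rewrite fmorph_eq0 => /eqP. Qed.

Lemma scat_not_equiv_pseudoregulus : ~ code_equivalent C (code_of (x_ 1)).
Proof.
move/code_equivalent_coefs => []; first by rewrite mxE.
move=> a [b [d [+ e2 e3 _ _]]]; rewrite !mxE /= in e2 e3.
have b0 : b = 0.
  do 2!apply: frob_eq0; apply: oppr_inj.
  by move: e3; rewrite !(mulr0, mulr1, rmorph0, addr0, add0r, oppr0).
have a0 : a = 0.
  do 2!apply: frob_eq0; apply: oppr_inj.
  by move: e2; rewrite b0 !(mul0r, mulr0, rmorph0, addr0, add0r, oppr0).
by rewrite a0 b0 eqxx.
Qed.

Section OddCharacteristic.

Hypothesis two_neq0 : 2 != 0 :> L.

(** The equations give [s (s b) = b * delta = s a] and [s b = - a], hence [s a = - s a]. *)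
Lemma scat_not_equiv_x1_x5 (delta : L) :
  ~ code_equivalent C (code_of (delta *: x_ 1 + x_ 5)).
Proof.
move/code_equivalent_coefs => []; first by rewrite !mxE /= mulr0 addr0.
move=> a [b [d [+ e2 e3 e4 _]]]; rewrite !mxE /= in e2 e3 e4.
rewrite !(mulr0, mulr1, rmorph0, addr0, add0r, subr0, oppr0) in e2 e3 e4.
have bE : s b = - a.
  by do 4!apply: (fmorph_inj s); rewrite !rmorphN; apply/eqP; rewrite -addr_eq0 addrC e4.
have b1 : s (s b) = b * delta.
  by do 2!apply: (fmorph_inj s); apply/eqP; rewrite -subr_eq0 addrC e3.
have b2 : b * delta = s a.
  by apply: (fmorph_inj s); apply: subr0_eq.
have a0 : a = 0.
  apply: frob_eq0; apply: eq_oppr0 two_neq0 _.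
  by rewrite -{1}b2 -b1 bE rmorphN.
have b0 : b = 0 by apply: frob_eq0; rewrite bE a0 oppr0.
by rewrite a0 b0 eqxx.
Qed.

(** After eliminating [delta] by [b * delta = s^3 b], the equations make [2 * s^3 b] equal to both
    [s a] and [- s a]. *)
Lemma scat_not_equiv_x1_x4 (delta : L) :
  ~ code_equivalent C (code_of (delta *: x_ 1 + x_ 4)).
Proof.
move/code_equivalent_coefs => []; first by rewrite !mxE /= mulr0 addr0.
move=> a [b [d [+ e2 e3 _ e5]]]; rewrite !mxE /= in e2 e3 e5.
rewrite !(mulr0, mulr1, rmorph0, addr0, add0r, subr0, oppr0) in e2 e3 e5.
have b3 : s (s (s b)) = b * delta.
  by do 2!apply: (fmorph_inj s); apply/eqP; rewrite -subr_eq0 addrC e3.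
rewrite -b3 !(frob6 dimK) in e2 e5.
have {}e5 : 2 * b + s (s (s (s a))) = 0.
  by apply: frob_eq0; rewrite rmorphD rmorphM rmorph_nat -e5 mulr_natl mulr2n.
have {}e2 : 2 * s (s (s b)) - s a = 0.
  by apply: frob_eq0; rewrite rmorphB rmorphM rmorph_nat -e2; ring.
have a0 : a = 0.
  apply: frob_eq0; apply: eq_oppr0 two_neq0 _; rewrite -[LHS](subr0_eq e2).
  move/eqP: e5; rewrite addr_eq0 => /eqP /(congr1 (fun y => s (s (s y)))).
  by rewrite !rmorphN /= !(frob6 dimK) !rmorphM !rmorph_nat => ->.
have b0 : b = 0.
  apply/eqP; move/eqP: e5; rewrite a0 !rmorph0 addr0 mulf_eq0.
  by rewrite (negPf two_neq0).
by rewrite a0 b0 eqxx.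
Qed.

Lemma scat_not_equiv_x1_x3_x5 (delta : L) : 5 != 0 :> L ->
  delta ^+ 2 + delta = 1 ->
  ~ code_equivalent C (code_of (x_ 1 + x_ 3 + delta *: x_ 5)).
Proof.
move=> five_neq0 deltaE.
(* [s] permutes the roots [delta] and [- 1 - delta] of [X^2 + X - 1]. *)
have s2delta : s (s delta) = delta.
  have sdE : (s delta) ^+ 2 + s delta = 1.
    by rewrite -rmorphXn -rmorphD deltaE rmorph1.
  have /eqP : (s delta - delta) * (s delta + delta + 1) = 0.
    transitivity ((s delta ^+ 2 + s delta) - (delta ^+ 2 + delta)); first by ring.
    by rewrite sdE deltaE subrr.
  rewrite mulf_eq0 subr_eq0 => /orP[/eqP sd|]; first by rewrite !sd.
  rewrite -addrA addr_eq0 => /eqP sd.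
  rewrite sd rmorphN rmorphD /= sd rmorph1; ring.
move/code_equivalent_coefs => []; first by rewrite !mxE /= mulr0 !addr0.
move=> a [b [d [+ e2 _ e4 _]]]; rewrite !mxE /= in e2 e4.
rewrite !(mulr0, mulr1, rmorph0, addr0, add0r, subr0, oppr0) in e2 e4.
have aE : s a = b + s (s (s (s b))).
  apply: (fmorph_inj s); apply/eqP; rewrite -subr_eq0 -oppr_eq0 -e2.
  by apply/eqP; rewrite rmorphD; ring.
rewrite aE !(rmorphD, rmorphM) /= !(frob6 dimK) !s2delta in e4.
(* With [a] eliminated, applying [s^2] twice yields a circulant system in [b], [s^2 b], [s^4 b]. *)
have eb : b + b + s (s b) + delta * s (s (s (s b))) = 0.
  apply: frob_eq0; rewrite !(rmorphD, rmorphM) -e4; ring.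
have eb2 : s (s b) + s (s b) + s (s (s (s b))) + delta * b = 0.
  have := congr1 (fun y => s (s y)) eb.
  by rewrite !(rmorphD, rmorphM) /= !rmorph0 s2delta (frob6 dimK).
have eb4 : s (s (s (s b))) + s (s (s (s b))) + b + delta * s (s b) = 0.
  have := congr1 (fun y => s (s y)) eb2.
  by rewrite !(rmorphD, rmorphM) /= !rmorph0 s2delta (frob6 dimK).
(* The circulant matrix with first row [2, 1, delta] has determinant          *)
(* [9 + delta ^+ 3 - 6 * delta = 4 * (2 - delta)].                            *)
have det : 4 * (2 - delta) * b = 0.
  transitivity ((4 - delta) * (b + b + s (s b) + delta * s (s (s (s b))))
    + (delta ^+ 2 - 2) * (s (s b) + s (s b) + s (s (s (s b))) + delta * b)
    + (1 - 2 * delta) * (s (s (s (s b))) + s (s (s (s b))) + b + delta * s (s b))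
    + (delta ^+ 2 + delta - 1) * (1 - delta) * b); first by ring.
  by rewrite eb eb2 eb4 deltaE subrr; ring.
have b0 : b = 0.
  have two_delta : 2 - delta != 0.
    apply: contraNneq five_neq0 => /subr0_eq d2.
    have /eqP := deltaE; rewrite -d2 -subr_eq0 => /eqP five0.
    by apply/eqP; rewrite -five0; ring.
  apply/eqP; move/eqP: det; rewrite (_ : 4 = 2 * 2); last by ring.
  by rewrite !mulf_eq0 (negPf two_neq0) (negPf two_delta).
have a0 : a = 0 by apply: frob_eq0; rewrite aE b0 !rmorph0 addr0.
by rewrite a0 b0 eqxx.
Qed.

End OddCharacteristic.

End Degree6.

(** * Arithmetic of [q] *)

Lemma card_pchar_pow (F : finFieldType) (K : fieldExtType F) (p : nat) :
  prime p -> p%:R = 0 :> finvect_type K -> exists2 k, (0 < k)%N & #|F| = (p ^ k)%N.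
Proof.
move=> p_pr p0; have charK : p \in [pchar finvect_type K].
  by rewrite inE p_pr p0 /=.
have := card_pchar_nat (in_alg (finvect_type K)) 1.
rewrite expn1 (eq_pnat _ (pcharf_eq charK)) => /p_natP[k qE]; exists k => //.
by move: (finNzRing_gt1 F); rewrite qE; case: k {qE}.
Qed.

(** With [q = 4 m + 1], some nonzero [x] is not a root of [X^(2m) - 1]; then [x^(2m) = -1] and [x^m]
    is the root sought. *)
Lemma finField_sqrtN1 (F : finFieldType) :
  #|F| = 1 %[mod 4] -> exists i : F, i ^+ 2 = -1.
Proof.
move=> q_mod4; have q1 := finNzRing_gt1 F.
have [m qE] : exists m, #|F| = (4 * m).+1.
  by exists (#|F| %/ 4)%N; rewrite {1}(divn_eq #|F| 4) q_mod4 mulnC addn1.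
have m0 : (0 < m)%N by case: m qE q1 => // ->.
pose r := enum (predC1 (0 : F)).
have p_neq0 : 'X^(2 * m) - 1 != 0 :> {poly F}.
  by rewrite -size_poly_gt0 size_XnsubC // muln_gt0.
have sz_r : size r = (4 * m)%N by rewrite -cardE cardC1 qE.
have /allPn[x] : ~~ all (root ('X^(2 * m) - 1)) r.
  apply/negP => /(max_poly_roots p_neq0)/(_ (enum_uniq _)).
  rewrite sz_r size_XnsubC ?muln_gt0 // ltnS leq_mul2r => /orP[/eqP m_eq0|//].
  by rewrite m_eq0 in m0.
rewrite mem_enum inE /root !hornerE => x0 x2m; exists (x ^+ m).
have : (x ^+ (2 * m)) ^+ 2 = 1.
  apply: (mulIf x0); rewrite mul1r -exprM mulnAC -exprSr -qE; exact: expf_card.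
move/eqP; rewrite sqrf_eq1 -subr_eq0 (negPf x2m) => /eqP.
by rewrite mulnC exprM.
Qed.




Theorem theorem6p3 (q : nat)
    (q_prime_power : exists p e : nat, [/\ prime p, (0 < e)%N & q = (p ^ e)%N])
    (q_le17 : (q <= 17)%N) (q_mod4 : q = 1 %[mod 4]) (q_neq5 : q <> 5%N)
    (F : finFieldType) (cardF : #|F| = q)
    (K : fieldExtType F) (dimK : \dim {:K} = 6%N) :
  let L := finvect_type K in
  let x_ (i : nat) : qpoly_ring K 6 := qmonom K 6 i in
  let C := code_of (x_ 1%N - x_ 2%N + x_ 4%N + x_ 5%N) in
  [/\ Fq_linear C,
      MRD C 5,
      ring_isomorphic_to_field (left_idealiser C)
    & forall f : qpoly_ring K 6,
        [\/ f = x_ 1%N,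
            exists delta : L,
              let N := delta ^+ ((q ^ 6 - 1) %/ (q - 1)) in
              [/\ N != 0, N != 1 & f = delta *: x_ 1%N + x_ 5%N],
            exists delta : L,
              let N := delta ^+ (q ^ 3 + 1) in
              [/\ N != 0, N != 1, f = delta *: x_ 1%N + x_ 4%N
                & maximum_scattered f]
          | exists delta : L,
              delta ^+ 2 + delta = 1
              /\ f = x_ 1%N + x_ 3%N + delta *: x_ 5%N] ->
        ~ code_equivalent C (code_of f)].
Proof.
move=> L x_ C.
have pcharL p : prime p -> p%:R = 0 :> L -> exists2 k, (0 < k)%N & q = (p ^ k)%N.
  by move=> p_pr /(card_pchar_pow p_pr); rewrite cardF.
have two_neq0 : 2 != 0 :> L.
  apply/eqP => /(@pcharL 2 isT)[[//|k] _ qE]; move: q_mod4.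
  by rewrite qE expnS => /(congr1 (fun m => m %% 2)%N); rewrite !modn_dvdm // modnMr.
(* In characteristic 5, [q] is 5 or at least 25. *)
have five_neq0 : 5 != 0 :> L.
  apply/eqP => /(@pcharL 5 isT)[[//|[//|k]] _ qE]; move: q_le17.
  by rewrite qE !expnS mulnA leqNgt (leq_trans _ (leq_pmulr _ _)) ?expn_gt0.
have [i i2] : exists i : F, i ^+ 2 = -1 by apply: finField_sqrtN1; rewrite cardF.
have im2 : (i%:A : L) ^+ 2 = -1 by rewrite -in_algE -rmorphXn i2 rmorphN1.
have frob_im : frob (i%:A : L) = i%:A.
  by rewrite /frob -in_algE -rmorphXn expf_card.
split; first exact: Fq_linear_code_of.
- exact: (MRD_scat dimK two_neq0 im2 frob_im).
- exact: (left_idealiser_scat_field dimK).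
move=> f [->|[delta [_ _ ->]]|[delta [_ _ -> _]]|[delta [deltaE ->]]].
- exact: (scat_not_equiv_pseudoregulus dimK).
- exact: (scat_not_equiv_x1_x5 dimK).
- exact: (scat_not_equiv_x1_x4 dimK).
- exact: (scat_not_equiv_x1_x3_x5 dimK).
Qed.
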